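(* Let $\mathfrak D\subset\mathbb C$ be an arbitrary stability region, $\mathcal G\subset\mathcal M^{n\times n}$ an arbitrary matrix class, and $\circ$ a binary operation on $\mathcal M^{n\times n}$ satisfying $$(\mathbf G\circ\mathbf A)^T=\mathbf A^T\circ\mathbf G^T\qquad\text{for all }\mathbf A\in\mathcal M^{n\times n},\ \mathbf G\in\mathcal G.$$ Then a matrix $\mathbf A\in\mathcal M^{n\times n}$ is left $(\mathfrak D,\mathcal G,\circ)$-stable if and only if $\mathbf A^T$ is right $(\mathfrak D,\mathcal G^T,\circ)$-stable. If, in addition, $\mathcal G$ is closed with respect to matrix transposition (i.e. $\mathbf G\in\mathcal G$ if and only if $\mathbf G^T\in\mathcal G$) and $$\sigma(\mathbf G\circ\mathbf A)=\sigma(\mathbf A\circ\mathbf G)\qquad\text{for all }\mathbf A\in\mathcal M^{n\times n},\ \mathbf G\in\mathcal G,$$ then $\mathbf A\in\mathcal M^{n\times n}$ is (left) $(\mathfrak D,\mathcal G,\circ)$-stable if and only if $\mathbf A^T$ is (left) $(\mathfrak D,\mathcal G,\circ)$-stable.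
   Context: $\mathcal M^{n\times n}$ denotes the set of real $n\times n$ matrices, $\mathbf A^T$ the transpose of $\mathbf A$, and $\sigma(\mathbf A)\subset\mathbb C$ the spectrum (set of complex eigenvalues) of $\mathbf A$. A stability region is a set $\mathfrak D\subseteq\mathbb C$ such that $\lambda\in\mathfrak D$ implies $\overline\lambda\in\mathfrak D$. A matrix class is a subset of $\mathcal M^{n\times n}$; $\mathcal G^T:=\{\mathbf G^T:\mathbf G\in\mathcal G\}$. A matrix $\mathbf A\in\mathcal M^{n\times n}$ is called left (respectively right) $(\mathfrak D,\mathcal G,\circ)$-stable if $\sigma(\mathbf G\circ\mathbf A)\subset\mathfrak D$ (respectively $\sigma(\mathbf A\circ\mathbf G)\subset\mathfrak D$) for every $\mathbf G\in\mathcal G$; ''$(\mathfrak D,\mathcal G,\circ)$-stable'' without qualifier means left stable. *)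

(* Defs.v *)
From mathcomp Require Import all_boot all_order all_algebra.
From mathcomp Require Import complex.
From mathcomp Require Import classical_sets reals.

Set Implicit Arguments.
Unset Strict Implicit.
Unset Printing Implicit Defensive.

Import GRing.Theory.

Local Open Scope ring_scope.
Local Open Scope complex_scope.
Local Open Scope classical_set_scope.

(* The eigenvalues of a real matrix, taken over the complex numbers R[i].
   MathComp's [eigenvalue] uses row eigenvectors: z is an eigenvalue of M when
   v *m M = z *: v for some nonzero row vector v. *)
Definition spectrum (R : realType) (n : nat) (A : 'M[R]_n) : set R[i] :=
  [set z | eigenvalue (map_mx (real_complex R) A) z].

Definition stability_region (R : realType) (D : set R[i]) : Prop :=
  forall z, D z -> D z^*.

Definition transpose_class (R : realType) (n : nat) (G : set 'M[R]_n) :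
    set 'M[R]_n :=
  trmx @` G.

Definition transpose_closed (R : realType) (n : nat) (G : set 'M[R]_n) : Prop :=
  forall M, G M <-> G M^T.

Definition left_stable (R : realType) (n : nat) (D : set R[i])
    (G : set 'M[R]_n) (op : 'M[R]_n -> 'M[R]_n -> 'M[R]_n) (A : 'M[R]_n) : Prop :=
  forall M, G M -> spectrum (op M A) `<=` D.

Definition right_stable (R : realType) (n : nat) (D : set R[i])
    (G : set 'M[R]_n) (op : 'M[R]_n -> 'M[R]_n -> 'M[R]_n) (A : 'M[R]_n) : Prop :=
  forall M, G M -> spectrum (op A M) `<=` D.

(* Main.v *)
Require Import Defs.
From mathcomp Require Import all_boot all_order all_algebra.
From mathcomp Require Import complex.
From mathcomp Require Import classical_sets reals.

Local Open Scope ring_scope.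

(** A matrix and its transpose have the same spectrum ([spectrum_trmx]), so transposing a product by
    [hop] swaps its factors without moving eigenvalues. This exchanges left and right stability;
    commutation of the spectra then turns right back into left. *)

(** Row eigenvectors of [A^T] are column eigenvectors of [A], so the comparison goes through
    characteristic polynomials: [X I - A^T] is the transpose of [X I - A], with the same
    determinant. *)
Lemma eigenvalue_trmx (F : fieldType) (n : nat) (A : 'M[F]_n) :
  eigenvalue A^T =1 eigenvalue A.
Proof.
move=> a; rewrite !eigenvalue_root_char; congr root.
rewrite -[RHS]det_tr; congr (\det _).
by apply/matrixP => i j; rewrite !mxE eq_sym.
Qed.

Lemma spectrum_trmx (R : realType) (n : nat) (A : 'M[R]_n) :
  spectrum A^T = spectrum A.
Proof.
by apply/seteqP; split=> z; rewrite /spectrum /= -map_trmx eigenvalue_trmx.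
Qed.

Theorem theorem9 (R : realType) (n : nat) (D : set R[i]) (G : set 'M[R]_n)
    (op : 'M[R]_n -> 'M[R]_n -> 'M[R]_n)
    (hD : stability_region D)
    (hop : forall A M : 'M[R]_n, G M -> (op M A)^T = op A^T M^T) :
  (forall A : 'M[R]_n,
     left_stable D G op A <-> right_stable D (transpose_class G) op A^T) /\
  (transpose_closed G ->
   (forall A M : 'M[R]_n, G M -> spectrum (op M A) = spectrum (op A M)) ->
   forall A : 'M[R]_n, left_stable D G op A <-> left_stable D G op A^T).
Proof.
split=> [A|Gtr spC].
  split=> [lA _ [M GM <-]|rA M GM].
    by rewrite -hop // spectrum_trmx; apply: lA.
  by rewrite -spectrum_trmx hop //; apply: rA; exists M.
have left_trmx A : left_stable D G op A -> left_stable D G op A^T.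
  move=> lA M GM; have GMt := (Gtr M).1 GM.
  (* The spectrum of [op M A^T] equals that of its transpose [op A M^T], hence that of [op M^T A],
     with [M^T] in [G]. *)
  by rewrite -spectrum_trmx hop // trmxK -spC //; apply: lA.
move=> A; split=> [|lAt]; first exact: left_trmx.
(* Transposition is an involution, so the converse is the same implication applied to [A^T]. *)
by rewrite -[A]trmxK; apply: left_trmx.
Qed.
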